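(* Let $(R,\mathfrak m)$ be a local integral domain (not necessarily noetherian), and let $\widetilde R$ be its $R$-completion. If $\widetilde R$ is Cohen-Macaulay, then $R$ is Cohen-Macaulay.
   Context: For an integral domain $R$ with fraction field $Q$, $\widetilde R=\varprojlim_{0\ne r\in R}R/rR$ is the completion of $R$ in the $R$-topology, identified with $\operatorname{End}_R(Q/R)$; when $R$ is local (not a field) with maximal ideal $\mathfrak m$, it is a commutative local ring with maximal ideal $\mathfrak m\widetilde R$. Let $A$ be a commutative ring, $\mathfrak a$ an ideal, $M$ an $A$-module. A finite sequence $x_1,\dots,x_r$ in $A$ is a weak regular sequence on $M$ if $x_i$ is a nonzerodivisor on $M/(x_1,\dots,x_{i-1})M$ for $i=1,\dots,r$. The classical grade $\operatorname{grade}_A(\mathfrak a,M)$ is the supremum of the lengths of weak regular sequences on $M$ contained in $\mathfrak a$. The polynomial grade is $$\operatorname{p.grade}_A(\mathfrak a,M)=\lim_{m\to\infty}\operatorname{grade}_{A[t_1,\dots,t_m]}\bigl(\mathfrak aA[t_1,\dots,t_m],\,A[t_1,\dots,t_m]\otimes_A M\bigr).$$ A commutative local ring $(A,\mathfrak n)$ (not necessarily noetherian) is called Cohen-Macaulay if $\operatorname{p.grade}_A(\mathfrak n,A)=\dim A$ (Krull dimension). *)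

(* Defs.v *)
From HB Require Import structures.
From mathcomp Require Import all_boot all_order all_algebra ring_quotient.
From mathcomp Require Import -(notations) mpoly.
From mathcomp Require Import boolp classical_sets reals ereal topology.
From mathcomp Require Import normedtype sequences Rstruct.

Set Implicit Arguments.
Unset Strict Implicit.
Unset Printing Implicit Defensive.

Import Order.TTheory GRing.Theory Num.Theory.

Local Open Scope classical_set_scope.
Local Open Scope ring_scope.
Local Open Scope quotient_scope.

(* [comPzRingType] is used wherever the zero ring must be allowed: R/rR is zero
   when r is a unit, and hence so is the R-completion of a field. *)

Section Ideals.
Variable A : comPzRingType.
Implicit Types I J : set A.

Definition ideal I : Prop :=
  [/\ I 0, forall x y, I x -> I y -> I (x + y) & forall a x, I x -> I (a * x)].

Definition prime_ideal I : Prop :=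
  [/\ ideal I, ~ I 1 & forall x y, I (x * y) -> I x \/ I y].

Definition maximal_ideal I : Prop :=
  [/\ ideal I, ~ I 1 & forall J, ideal J -> ~ J 1 -> I `<=` J -> J = I].

Definition local_ring I : Prop :=
  maximal_ideal I /\ forall J, maximal_ideal J -> J = I.

(* Lengths are counted as in p 0 `<` p 1 `<` ... `<` p n; extended natural
   numbers are represented in the extended real line. *)
Definition krull_dim : \bar Rdefinitions.R :=
  ereal_sup [set n%:R%:E | n in [set n : nat | exists p : nat -> set A,
    (forall i, (i <= n)%N -> prime_ideal (p i)) /\
    (forall i, (i < n)%N -> p i `<` p i.+1)]].

Variable M : lmodType A.

Definition ideal_smul (s : seq A) : set M :=
  [set y | exists v : 'I_(size s) -> M, y = \sum_(j < size s) s`_j *: v j].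

(* x is a nonzerodivisor on M/N *)
Definition nonzerodivisor_mod (N : set M) (x : A) : Prop :=
  forall y : M, N (x *: y) -> N y.

Definition weak_regular (s : seq A) : Prop :=
  forall i, (i < size s)%N ->
    nonzerodivisor_mod (ideal_smul (take i s)) s`_i.

Definition grade (I : set A) : \bar Rdefinitions.R :=
  ereal_sup [set (size s)%:R%:E | s in [set s : seq A |
    weak_regular s /\ (forall x, x \in s -> I x)]].

End Ideals.

Definition ideal_ext (A B : comPzRingType) (f : A -> B) (I : set A) : set B :=
  smallest (@ideal B) (f @` I).

(* The polynomial grade p.grade_A(I, A), where A[t] (x)_A A is A[t]. *)
Definition p_grade (A : comNzRingType) (I : set A) : \bar Rdefinitions.R :=
  limn (fun m => grade (mpoly m A : comNzRingType)^o (ideal_ext (@mpolyC m A) I)).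

(* A copy of A carrying the instance required to form polynomial rings. *)
Definition nonzero_ring (A : comPzRingType) (A1 : 1 != 0 :> A) : Type := A.

HB.instance Definition _ (A : comPzRingType) (A1 : 1 != 0 :> A) :=
  GRing.ComPzRing.on (nonzero_ring A1).
HB.instance Definition _ (A : comPzRingType) (A1 : 1 != 0 :> A) :=
  GRing.PzSemiRing_isNonZero.Build (nonzero_ring A1) A1.

Definition Cohen_Macaulay (A : comPzRingType) : Prop :=
  exists A1 : 1 != 0 :> A, exists2 n : set A, local_ring n &
    @p_grade (nonzero_ring A1) n = krull_dim A.

Section PrincipalQuotient.
Variables (R : comPzRingType) (r : R).

Definition principal : {pred R} := fun x => `[< exists c, x = c * r >].

Lemma principal_zmod_closed : zmod_closed principal.
Proof.
split; first by apply/asboolP; exists 0; rewrite mul0r.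
move=> _ _ /asboolP[c ->] /asboolP[d ->].
by apply/asboolP; exists (c - d); rewrite mulrBl.
Qed.

HB.instance Definition _ :=
  GRing.isZmodClosed.Build R principal principal_zmod_closed.

(* The library only provides [{ideal_quot _}] with a ring structure
   for proper ideals. *)
Definition quo : Type := {ideal_quot principal}.

HB.instance Definition _ := Choice.on quo.
HB.instance Definition _ := GRing.Zmodule.on quo.
HB.instance Definition _ := EqQuotient.on quo.

Definition quo_pi (x : R) : quo := \pi_quo x.

Lemma quo_eqP (x y : R) : quo_pi x = quo_pi y <-> exists c, x - y = c * r.
Proof.
split=> [/eqP|]; rewrite /quo_pi.
  by rewrite -Quotient.idealrBE => /asboolP.
by move=> h; apply/eqP; rewrite -Quotient.idealrBE; apply/asboolP.
Qed.

Lemma quo_piK (x : quo) : quo_pi (repr x) = x.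
Proof. exact: reprK. Qed.

Lemma quo_pi_zmod : zmod_morphism quo_pi.
Proof. exact: (@pi_is_zmod_morphism _ _ _ {ideal_quot principal}). Qed.

HB.instance Definition _ := GRing.isZmodMorphism.Build R quo quo_pi quo_pi_zmod.

Definition quo_mul (x y : quo) : quo := quo_pi (repr x * repr y).

Lemma quo_piM : {morph quo_pi : x y / x * y >-> quo_mul x y}.
Proof.
move=> x y; apply/quo_eqP.
have /quo_eqP[c hc] := esym (quo_piK (quo_pi x)).
have /quo_eqP[d hd] := esym (quo_piK (quo_pi y)).
move: hc hd; set x' := repr _; set y' := repr _ => hc hd.
exists (c * y + x' * d).
by rewrite mulrDl (mulrAC c) -hc -(mulrA x') -hd mulrBl mulrBr addrA subrK.
Qed.

Lemma quo_mulA : associative quo_mul.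
Proof.
move=> x y z; rewrite -[x]quo_piK -[y]quo_piK -[z]quo_piK.
by rewrite -!quo_piM mulrA.
Qed.

Lemma quo_mulC : commutative quo_mul.
Proof. by move=> x y; rewrite /quo_mul mulrC. Qed.

Lemma quo_mul1 : left_id (quo_pi 1) quo_mul.
Proof. by move=> x; rewrite -[x]quo_piK -quo_piM mul1r. Qed.

Lemma quo_mulDl : left_distributive quo_mul +%R.
Proof.
move=> x y z; rewrite -[x]quo_piK -[y]quo_piK -[z]quo_piK.
by rewrite -raddfD -!quo_piM mulrDl raddfD.
Qed.

HB.instance Definition _ := GRing.Zmodule_isComPzRing.Build quo
  quo_mulA quo_mulC quo_mul1 quo_mulDl.

Lemma quo_pi_monoid : monoid_morphism quo_pi.
Proof. by split=> //; exact: quo_piM. Qed.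

HB.instance Definition _ :=
  GRing.isMonoidMorphism.Build R quo quo_pi quo_pi_monoid.

End PrincipalQuotient.
Arguments quo {R} r.
Arguments quo_pi {R} r x.

Section DependentProduct.
Variables (T : Type) (M : T -> comPzRingType).

Definition dprod : Type := forall t, M t.
Implicit Types f g : dprod.

HB.instance Definition _ := gen_eqMixin dprod.
HB.instance Definition _ := gen_choiceMixin dprod.

Definition dprod_zero : dprod := fun=> 0.
Definition dprod_one : dprod := fun=> 1.
Definition dprod_opp f : dprod := fun t => - f t.
Definition dprod_add f g : dprod := fun t => f t + g t.
Definition dprod_mul f g : dprod := fun t => f t * g t.

Lemma dprod_addA : associative dprod_add.
Proof. by move=> f g h; apply/functional_extensionality_dep => t; exact: addrA. Qed.
Lemma dprod_addC : commutative dprod_add.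
Proof. by move=> f g; apply/functional_extensionality_dep => t; exact: addrC. Qed.
Lemma dprod_add0 : left_id dprod_zero dprod_add.
Proof. by move=> f; apply/functional_extensionality_dep => t; exact: add0r. Qed.
Lemma dprod_addN : left_inverse dprod_zero dprod_opp dprod_add.
Proof. by move=> f; apply/functional_extensionality_dep => t; exact: addNr. Qed.

HB.instance Definition _ :=
  GRing.isZmodule.Build dprod dprod_addA dprod_addC dprod_add0 dprod_addN.

Lemma dprod_mulA : associative dprod_mul.
Proof. by move=> f g h; apply/functional_extensionality_dep => t; exact: mulrA. Qed.
Lemma dprod_mulC : commutative dprod_mul.
Proof. by move=> f g; apply/functional_extensionality_dep => t; exact: mulrC. Qed.
Lemma dprod_mul1 : left_id dprod_one dprod_mul.
Proof. by move=> f; apply/functional_extensionality_dep => t; exact: mul1r. Qed.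
Lemma dprod_mulDl : left_distributive dprod_mul +%R.
Proof. by move=> f g h; apply/functional_extensionality_dep => t; exact: mulrDl. Qed.

HB.instance Definition _ := GRing.Zmodule_isComPzRing.Build dprod
  dprod_mulA dprod_mulC dprod_mul1 dprod_mulDl.

End DependentProduct.

(* The inverse limit of the rings R/rR, r != 0, along the natural surjections
   R/sR -> R/rR for sR included in rR, as a subring of their product. *)
Section Completion.
Variable R : comNzRingType.

Let nz := {r : R | r != 0}.

Definition quo_prod := @dprod nz (fun r => quo (val r)).
HB.instance Definition _ := GRing.ComPzRing.on quo_prod.

Definition coherent : {pred quo_prod} := fun f =>
  `[< forall r s : nz, (exists c, val s = c * val r) ->
      forall a : R, f s = quo_pi (val s) a -> f r = quo_pi (val r) a >].

Lemma coherent_subring_closed : subring_closed coherent.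
Proof.
have step (r s : nz) (a b : R) : (exists c, val s = c * val r) ->
    quo_pi (val s) a = quo_pi (val s) b -> quo_pi (val r) a = quo_pi (val r) b.
  move=> [c sE] /quo_eqP[d ab]; apply/quo_eqP.
  by exists (d * c); rewrite ab sE mulrA.
split.
- by apply/asboolP => r s rs a; exact: step.
- move=> f g /asboolP cf /asboolP cg; apply/asboolP => r s rs a E.
  have -> : (f - g) r = f r - g r by [].
  rewrite (cf r s rs _ (esym (quo_piK (f s)))).
  rewrite (cg r s rs _ (esym (quo_piK (g s)))) -rmorphB.
  by apply: step rs _; rewrite -E rmorphB /= !quo_piK.
- move=> f g /asboolP cf /asboolP cg; apply/asboolP => r s rs a E.
  have -> : (f * g) r = f r * g r by [].
  rewrite (cf r s rs _ (esym (quo_piK (f s)))).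
  rewrite (cg r s rs _ (esym (quo_piK (g s)))) -rmorphM.
  by apply: step rs _; rewrite -E rmorphM /= !quo_piK.
Qed.

Record completion := Completion {
  completion_val :> quo_prod;
  completion_coherent : coherent completion_val }.

HB.instance Definition _ := [isSub for completion_val].
HB.instance Definition _ := [Choice of completion by <:].
HB.instance Definition _ := GRing.SubChoice_isSubComPzRing.Build
  quo_prod coherent completion coherent_subring_closed.

End Completion.

(* Main.v *)
(* Let K(x; A) be the Koszul cochain complex of a finite sequence x in A. The
   polynomial grade of an ideal I is the supremum of the n such that
   H^i(x; A) = 0 for i < n, for some finite x in I: a weak regular sequence of
   length n in (x) kills the first n cohomology groups, and conversely McCoy's
   theorem makes the generic combination of x in a new variable a
   nonzerodivisor as long as H^0 vanishes.
   For A local this grade is at most dim A: if dim A = d, a non-noetherian form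
   of Kronecker's theorem (through Krull boundary ideals) puts x in the radical
   of an ideal generated by d elements, whose Koszul complex has H^d <> 0.
   Let now r be a nonzero element of the maximal ideal m of R, and write R~ for
   the completion. As r is a nonzerodivisor in both rings and R/rR = R~/rR~,
   dividing by r gives p.grade(mR~, R~) <= p.grade(m, R), and lifting chains of
   primes gives dim R <= dim R~. Hence
   dim R <= dim R~ = p.grade(mR~, R~) <= p.grade(m, R) <= dim R. *)

From HB Require Import structures.
Require Import Defs.
From mathcomp Require Import all_boot all_order all_algebra ring zify.
From mathcomp Require Import -(notations) mpoly.
From mathcomp Require Import boolp classical_sets reals ereal topology.
From mathcomp Require Import normedtype sequences Rstruct.

Set Implicit Arguments.
Unset Strict Implicit.
Unset Printing Implicit Defensive.

Import Order.TTheory GRing.Theory Num.Theory.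

Local Open Scope classical_set_scope.
Local Open Scope ring_scope.

(** * Ideals *)

Section IdealTheory.
Variable A : comPzRingType.
Implicit Types (J K m : set A) (s : seq A).

Lemma ideal0 J : ideal J -> J 0. Proof. by case. Qed.
Lemma idealD J x y : ideal J -> J x -> J y -> J (x + y).
Proof. by case=> _ + _; exact. Qed.
Lemma idealMl J a x : ideal J -> J x -> J (a * x).
Proof. by case=> _ _; exact. Qed.
Lemma idealMr J a x : ideal J -> J x -> J (x * a).
Proof. by move=> ? ?; rewrite mulrC; exact: idealMl. Qed.
Lemma idealN J x : ideal J -> J x -> J (- x).
Proof. by rewrite -mulN1r => ? ?; exact: idealMl. Qed.
Lemma idealB J x y : ideal J -> J x -> J y -> J (x - y).
Proof. by move=> iJ ? ?; apply: idealD => //; exact: idealN. Qed.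
Lemma ideal_sum J (I : Type) (r : seq I) (P : pred I) (F : I -> A) :
  ideal J -> (forall i, P i -> J (F i)) -> J (\sum_(i <- r | P i) F i).
Proof.
move=> iJ JF; apply: (@big_ind _ J) => //; first exact: ideal0.
by move=> x y; exact: idealD.
Qed.
Lemma ideal_subr J x y : ideal J -> J (x - y) -> J x <-> J y.
Proof.
move=> iJ Jxy; split=> [Jx|Jy]; last by rewrite -(subrK y x); exact: idealD.
by rewrite -(subKr x y); exact: idealB.
Qed.
Lemma ideal_full J x : ideal J -> J 1 -> J x.
Proof. by move=> iJ J1; rewrite -(mulr1 x); exact: idealMl. Qed.
Lemma idealX J a k l : ideal J -> (k <= l)%N -> J (a ^+ k) -> J (a ^+ l).
Proof. by move=> iJ kl Jk; rewrite -(subnK kl) exprD; exact: idealMl. Qed.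

Lemma zero_ideal : ideal [set 0 : A].
Proof.
by split=> [//|_ _ -> ->|a _ ->]; rewrite ?addr0 ?mulr0.
Qed.

Definition addI J f : set A := [set y | exists v, J (y - v * f)].

Lemma addI_ideal J f : ideal J -> ideal (addI J f).
Proof.
move=> iJ; split.
- by exists 0; rewrite mul0r subr0; exact: ideal0.
- move=> x y [v Jx] [w Jy]; exists (v + w).
  by rewrite mulrDl opprD addrACA; exact: idealD.
- move=> a x [v Jx]; exists (a * v); rewrite -mulrA -mulrBr; exact: idealMl.
Qed.

Lemma sub_addI J f x : J x -> addI J f x.
Proof. by exists 0; rewrite mul0r subr0. Qed.

Lemma addI_mem J f : ideal J -> addI J f f.
Proof. by exists 1; rewrite mul1r subrr; exact: ideal0. Qed.

Definition gen s : set A := @ideal_smul A A^o s.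

Lemma gen_nilE : gen [::] = [set 0].
Proof.
apply/seteqP; split=> [y [v]|y ->] /=; first by rewrite big_ord0.
by exists (fun=> 0); rewrite big_ord0.
Qed.

Lemma gen_cons f s y : gen (f :: s) y <-> exists v, gen s (y - v * f).
Proof.
split=> [[v /= ->]|[v [w e]]].
  exists (v ord0); exists (fun j => v (lift ord0 j)).
  by rewrite big_ord_recl /= [v ord0 * f]mulrC addrC addKr.
exists (fun j => if unlift ord0 j is Some k then w k else v).
rewrite big_ord_recl /= unlift_none -(subrK (v * f) y) e addrC.
congr (_ + _); first by rewrite mulrC.
by apply: eq_bigr => j _; rewrite liftK.
Qed.

Lemma gen_ideal s : ideal (gen s).
Proof.
elim: s => [|f s IH]; first by rewrite gen_nilE; exact: zero_ideal.
suff -> : gen (f :: s) = addI (gen s) f by exact: addI_ideal.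
by apply/seteqP; split=> y /gen_cons.
Qed.

Lemma gen_mem s x : x \in s -> gen s x.
Proof.
elim: s => // f s IH; rewrite inE => /predU1P[->|/IH sx]; apply/gen_cons.
  by exists 1; rewrite mul1r subrr; exact: ideal0 (gen_ideal s).
by exists 0; rewrite mul0r subr0.
Qed.

Lemma gen_sub J s : ideal J -> (forall x, x \in s -> J x) -> gen s `<=` J.
Proof.
move=> iJ; elim: s => [|f s IH] Js y; first by rewrite gen_nilE => ->; exact: ideal0.
move=> /gen_cons[v sv]; rewrite -(subrK (v * f) y); apply: idealD => //.
  by apply: IH sv => x xs; apply: Js; rewrite inE xs orbT.
by apply: idealMl => //; apply: Js; rewrite mem_head.
Qed.

Lemma gen_subset s1 s2 : {subset s1 <= s2} -> gen s1 `<=` gen s2.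
Proof.
by move=> s12; apply: gen_sub (gen_ideal s2) _ => x /s12 /gen_mem.
Qed.

Lemma gen_rcons s f : gen (rcons s f) = addI (gen s) f.
Proof.
apply/seteqP; split=> [|y [v sv]].
  apply: gen_sub; first exact: addI_ideal (gen_ideal s).
  move=> x; rewrite mem_rcons inE => /predU1P[->|/gen_mem].
    exact: addI_mem (gen_ideal s).
  exact: sub_addI.
have ig := gen_ideal (rcons s f).
rewrite -(subrK (v * f) y); apply: (idealD ig).
  by apply: gen_subset sv => x xs; rewrite mem_rcons inE xs orbT.
by apply: (idealMl _ ig); apply: gen_mem; rewrite mem_rcons mem_head.
Qed.

(** Zorn's lemma gives an ideal P maximal among those containing J and missing S. If x and y lie
    outside P, then P + (x) and P + (y) both meet S; multiplying the two elements shows that xy is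
    outside P. The maximality clause is what yields maximal ideals when S = {1}. *)
Lemma ideal_disjoint_prime J (S : set A) : ideal J -> S 1 ->
  (forall x y, S x -> S y -> S (x * y)) -> (forall x, J x -> ~ S x) ->
  exists P, [/\ prime_ideal P, J `<=` P, forall x, P x -> ~ S x &
    forall K, ideal K -> P `<=` K -> (forall x, K x -> ~ S x) -> K = P].
Proof.
move=> iJ S1 SM JS.
pose good X := [/\ ideal X, J `<=` X & forall x, X x -> ~ S x].
have gJ : good J by split.
pose Q X := X = set0 \/ good X.
have [F FQ tF|P [QP Pmax]] := @Zorn_bigcup _ Q.
  have [[X FX gX]|noX] := pselect (exists2 X, F X & good X); last first.
    left; apply/seteqP; split=> // x [X FX Xx].
    by case: (FQ _ FX) => [X0|gX]; [rewrite X0 in Xx|case: noX; exists X].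
  have sub Y y : F Y -> Y y -> good Y.
    by move=> FY Yy; case: (FQ _ FY) => // Y0; rewrite Y0 in Yy.
  right; split; first split.
  - by exists X => //; case: gX => /ideal0.
  - move=> x y [Y FY Yx] [Z FZ Zy].
    case: (tF _ _ FY FZ) => [YZ|ZY].
      exists Z => //; case: (sub _ _ FZ Zy) => iZ _ _.
      by apply: idealD => //; exact: YZ.
    exists Y => //; case: (sub _ _ FY Yx) => iY _ _.
    by apply: idealD => //; exact: ZY.
  - move=> a x [Y FY Yx]; exists Y => //; case: (sub _ _ FY Yx) => iY _ _.
    exact: idealMl.
  - by move=> x Jx; exists X => //; case: gX => _ + _; exact.
  - by move=> x [Y FY Yx]; case: (sub _ _ FY Yx) => _ _; exact.
have {QP} gP : good P.
  case: QP => // P0; exfalso; apply: (Pmax J); last by right.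
  rewrite P0; rewrite properEneq; split=> //; apply/eqP => /esym J0.
  by have := ideal0 iJ; rewrite J0.
have {}Pmax K : ideal K -> P `<=` K -> (forall x, K x -> ~ S x) -> K = P.
  move=> iK PK KS; apply: contrapT => KP; apply: (Pmax K).
    by rewrite properEneq; split=> //; apply/eqP => /esym.
  by right; split=> //; case: gP => _ JP _; exact: subset_trans PK.
case: (gP) => iP JP PS.
have meet x : ~ P x -> exists2 s, S s & addI P x s.
  move=> Px; apply: contrapT => nS; apply: Px.
  rewrite -(Pmax (addI P x)); first exact: addI_mem.
  - exact: addI_ideal.
  - by move=> y; exact: sub_addI.
  - by move=> s xs Ss; apply: nS; exists s.
exists P; split=> //; split=> // [/PS //|x y Pxy].
apply: contrapT => /not_orP[/meet[s Ss [v Pv]] /meet[t St [w Pw]]].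
apply: (PS (s * t)); last exact: SM.
have -> : s * t = (s - v * x) * t + v * x * (t - w * y) + (v * w) * (x * y).
  by ring.
apply: idealD => //; last exact: idealMl.
by apply: idealD => //; [exact: idealMr|exact: idealMl].
Qed.

Lemma ideal_sub_prime J : ideal J -> ~ J 1 ->
  exists2 P, prime_ideal P & J `<=` P.
Proof.
move=> iJ J1; have [| |x Jx x1|P []] := @ideal_disjoint_prime J [set 1] iJ.
- by [].
- by move=> _ _ -> ->; rewrite mulr1.
- by rewrite x1 in Jx.
- by exists P.
Qed.

Lemma ideal_sub_maximal J : ideal J -> ~ J 1 ->
  exists2 P, maximal_ideal P & J `<=` P.
Proof.
move=> iJ J1; have [| |x Jx x1|P [pP JP PS Pmax]] :=
  @ideal_disjoint_prime J [set 1] iJ.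
- by [].
- by move=> _ _ -> ->; rewrite mulr1.
- by rewrite x1 in Jx.
- exists P => //; case: (pP) => iP P1 _; split=> // K iK K1 PK.
  by apply: Pmax => // x Kx x1; rewrite x1 in Kx.
Qed.

Lemma local_ring_sub m J : local_ring m -> ideal J -> ~ J 1 -> J `<=` m.
Proof.
move=> [_ mu] iJ J1; have [P /mu <-] := ideal_sub_maximal iJ J1.
exact.
Qed.

Lemma local_ring_unit m x : local_ring m -> ~ m x -> exists y, y * x = 1.
Proof.
move=> lm mx; apply: contrapT => nx; apply: mx.
apply: (local_ring_sub lm (gen_ideal [:: x])); last by apply: gen_mem; rewrite inE.
move=> /gen_cons[v]; rewrite gen_nilE => /eqP; rewrite subr_eq0 => /eqP e.
by apply: nx; exists v.
Qed.

End IdealTheory.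

(** * Vanishing of Koszul cohomology *)

Section Koszul.
Variable A : comPzRingType.
Implicit Types (J K : set A) (x b : seq A) (c e : seq bool -> A) (s : seq bool).

(* A Koszul cochain of x is a function on bit strings of length [size x], with
   a bit for each basis vector; its component of degree i consists of the
   values at strings with i bits set. Values at strings of another length are
   junk. *)
Fixpoint kd x c s : A :=
  match x, s with
  | a :: x', eps :: s' =>
    if eps then a * c (false :: s') - kd x' (fun s => c (true :: s)) s'
    else kd x' (fun s => c (false :: s)) s'
  | _, _ => 0
  end.

(* Contraction by b; it makes multiplication by the sum of the x_j b_j
   homotopic to zero, see [kd_kh]. *)
Fixpoint kh b c s : A :=
  match b, s with
  | b0 :: b', eps :: s' =>
    if eps then - kh b' (fun s => c (true :: s)) s'
    else b0 * c (true :: s') + kh b' (fun s => c (false :: s)) s'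
  | _, _ => 0
  end.

Lemma kdD x c e s : kd x (fun s => c s + e s) s = kd x c s + kd x e s.
Proof.
elim: x c e s => [|a x IH] c e [|[] s] /=; rewrite ?addr0 ?IH //.
by rewrite mulrDr opprD addrACA.
Qed.

Lemma kdZ x a c s : kd x (fun s => a * c s) s = a * kd x c s.
Proof.
elim: x c s => [|b x IH] c [|[] s] /=; rewrite ?mulr0 ?IH //.
by rewrite mulrBr mulrCA.
Qed.

Lemma kdB x c e s : kd x (fun s => c s - e s) s = kd x c s - kd x e s.
Proof.
rewrite -[in RHS]mulN1r -kdZ -kdD; congr kd.
by apply/funext => t; rewrite mulN1r.
Qed.

Lemma kd_sum (I : Type) (r : seq I) x (F : I -> seq bool -> A) s :
  kd x (fun s => \sum_(i <- r) F i s) s = \sum_(i <- r) kd x (F i) s.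
Proof.
elim: r => [|i r IH].
  rewrite big_nil -[RHS](mul0r (kd x (fun=> 0) s)) -[RHS]kdZ; congr kd.
  by apply/funext => t; rewrite big_nil mul0r.
rewrite big_cons -IH -kdD; congr kd.
by apply/funext => t; rewrite big_cons.
Qed.

Lemma kdK x c s : kd x (kd x c) s = 0.
Proof.
elim: x c s => [|a x IH] c [|[] s] //=.
by rewrite kdB kdZ IH subr0 subrr.
Qed.

Lemma khZB b a c e s : kh b (fun s => a * c s - e s) s = a * kh b c s - kh b e s.
Proof.
elim: b c e s => [|b0 b IH] c e [|[] s] /=; rewrite ?mulr0 ?subr0 ?IH //; by ring.
Qed.

(** Cartan's homotopy formula. The complex of [a :: x] is a mapping cone of multiplication by a on
    the complex of [x], and the cross terms between its two halves cancel. *)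
Lemma kd_kh x b c s : size b = size x -> size s = size x ->
  kd x (kh b c) s + kh b (kd x c) s = (\sum_(j < size x) x`_j * b`_j) * c s.
Proof.
elim: x b c s => [|a x IH] [|b0 b] c [|eps s] //= => [_ _|[sb] [ss]].
  by rewrite addr0 big_ord0 mul0r.
rewrite big_ord_recl /= (eq_bigr (fun j : 'I_(size x) => x`_j * b`_j)) //.
case: eps => /=.
  rewrite [kd x (fun s => - _) s](_ : _ = - kd x (kh b (fun s => c (true :: s))) s).
    rewrite mulrDl -(IH b (fun s => c (true :: s)) s sb ss).
    by rewrite khZB; ring.
  rewrite -[RHS]mulN1r -kdZ; congr kd.
  by apply/funext => t; rewrite mulN1r.
rewrite kdD kdZ mulrDl -(IH b (fun s => c (false :: s)) s sb ss).
by ring.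
Qed.

(** Contraction lowers the degree by one, so a congruence known only in one degree can be pushed
    through it; [kd_local] does the same for the differential. *)
Lemma kh_local J b c s : ideal J ->
  (forall t, size t = size s -> count id t = (count id s).+1 -> J (c t)) ->
  J (kh b c s).
Proof.
move=> iJ; elim: b c s => [|b0 b IH] c [|[] s] Jc /=; try exact: ideal0.
  apply: idealN => //; apply: IH => t st ct; apply: Jc; rewrite /= ?st //.
  by rewrite ct.
apply: idealD => //; first by apply: idealMl => //; exact: Jc.
by apply: IH => t st ct; apply: Jc; rewrite /= ?st.
Qed.

Lemma kd_deg0 x c s : count id s = 0%N -> kd x c s = 0.
Proof. by elim: x c s => [|a x IH] c [|[] s] //= cs; exact: IH. Qed.

Lemma kd_local J x c s : ideal J ->
  (forall t, size t = size s -> (count id t).+1 = count id s -> J (c t)) ->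
  J (kd x c s).
Proof.
move=> iJ; elim: x c s => [|a x IH] c [|[] s] Jc /=; try exact: ideal0.
  apply: idealB => //; first by apply: idealMl => //; exact: Jc.
  by apply: IH => t st ct; apply: Jc; rewrite /= ?st // -ct.
by apply: IH => t st ct; apply: Jc; rewrite /= ?st.
Qed.

Lemma kd_sub J x c s : ideal J -> (forall a, a \in x -> J a) -> J (kd x c s).
Proof.
move=> iJ; elim: x c s => [|a x IH] c [|[] s] Jx /=; try exact: ideal0.
  apply: idealB => //; first by apply: idealMr => //; apply: Jx; rewrite mem_head.
  by apply: IH => b bx; apply: Jx; rewrite inE bx orbT.
by apply: IH => b bx; apply: Jx; rewrite inE bx orbT.
Qed.

(** Vanishing of H^i(x; A/J) for i < n, written with cochains lifted to A and congruences modulo J,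
    which avoids forming quotient rings. *)
Definition acyclic x n J : Prop := forall i c, (i < n)%N ->
  (forall s, size s = size x -> count id s = i.+1 -> J (kd x c s)) ->
  exists e, forall s, size s = size x -> count id s = i -> J (c s - kd x e s).

Lemma acyclicW x n k J : (k <= n)%N -> acyclic x n J -> acyclic x k J.
Proof. by move=> kn ac i c ik; apply: ac; exact: leq_trans kn. Qed.

Lemma acyclic_full x n J : ideal J -> J 1 -> acyclic x n J.
Proof. by move=> iJ J1 i c _ _; exists (fun=> 0) => s _ _; exact: ideal_full. Qed.

(* The top Koszul cohomology is A / (J + (x)). *)
Lemma acyclic_top x n J K : ideal K -> J `<=` K -> (forall a, a \in x -> K a) ->
  acyclic x n J -> (size x < n)%N -> K 1.
Proof.
move=> iK JK Kx ac xn; have [s ss cs|e He] := ac (size x) (fun=> 1) xn.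
  by have := count_size id s; rewrite ss cs ltnn.
have := He (nseq (size x) true); rewrite size_nseq count_nseq mul1n => /(_ erefl erefl).
by move=> /JK K1; apply/(ideal_subr iK K1); exact: kd_sub.
Qed.

Definition nzd J f := nonzerodivisor_mod (M := A^o) J f.

(** In the long exact sequence of multiplication by f on A/J, H^i(x; A/(J + fA)) sits between H^i
    and H^(i+1) of A/J. Explicitly, if dc = fe then e is a cocycle, e = dg, and c - fg is a cocycle
    modulo J. *)
Lemma acyclic_addI x n J f : ideal J -> nzd J f ->
  acyclic x n.+1 J -> acyclic x n (addI J f).
Proof.
move=> iJ Jf ac i c lin dc.
have [e He] : exists e, forall s, size s = size x -> count id s = i.+1 ->
    J (kd x c s - f * e s).
  (* Guarding the property by length and degree lets choice produce a total cochain, with the junk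
     value 0 elsewhere. *)
  suff /choice[e He] : forall s, exists v, size s = size x -> count id s = i.+1 ->
    J (kd x c s - f * v) by exists e.
  move=> s; have [ss|/eqP nss] := eqVneq (size s) (size x); last by exists 0.
  have [cs|/eqP ncs] := eqVneq (count id s) i.+1; last by exists 0.
  by have [v Jv] := dc s ss cs; exists v; rewrite mulrC.
have [|g Hg] := ac i.+1 e lin.
  move=> s ss cs; apply: Jf; rewrite /GRing.scale /=.
  rewrite -[f * _]opprK -[- (f * _)]add0r -(kdK x c s) -kdZ -kdB.
  apply: idealN => //; apply: kd_local => // t st ct; apply: He; first by rewrite st.
  by apply: succn_inj; rewrite ct.
have [||e' He'] := ac i (fun s => c s - f * g s).
- exact: ltnW.
- move=> s ss cs; rewrite kdB kdZ.
  rewrite (_ : _ - _ = kd x c s - f * e s + f * (e s - kd x g s)); last by ring.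
  by apply: idealD; [|exact: He|apply: idealMl => //; exact: Hg].
exists e' => s ss cs; exists (g s).
by rewrite [g s * f]mulrC addrAC; exact: He'.
Qed.

(** As f lies in (x), it acts on cohomology by zero, so the connecting map from H^(i-1) of A/(J +
    fA) onto H^i of A/J is surjective. Explicitly, fc = d(hc) for the contraction h by the
    coefficients of f; then hc = de + fg, whence fc = f dg and f cancels. *)
Lemma addI_acyclic x n J f : ideal J -> nzd J f -> gen x f ->
  acyclic x n (addI J f) -> acyclic x n.+1 J.
Proof.
move=> iJ Jf [v /= fE] ac i c lin dc.
pose b := [seq v j | j <- enum 'I_(size x)].
have sb : size b = size x by rewrite size_map size_enum_ord.
have htpy s : size s = size x -> kd x (kh b c) s + kh b (kd x c) s = f * c s.
  move=> ss; rewrite kd_kh //; congr (_ * _); rewrite fE.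
  apply: eq_bigr => j _; congr (_ * _).
  by rewrite (nth_map j) ?size_enum_ord // nth_ord_enum.
have Jk s : size s = size x -> count id s = i -> J (f * c s - kd x (kh b c) s).
  move=> ss cs; rewrite -htpy // addrC addKr; apply: kh_local => // t st ct.
  by apply: dc; rewrite ?st // ct cs.
(* In degree 0 there are no coboundaries, so fc = 0 modulo J already gives c = 0. *)
case: i lin dc Jk => [|i] lin dc Jk.
  exists (fun=> 0) => s ss cs; rewrite kd_deg0 // subr0; apply: Jf.
  by have := Jk s ss cs; rewrite kd_deg0 // subr0.
have [//||e He] := ac i (kh b c).
  move=> s ss cs; exists (c s); have := Jk s ss cs.
  by move=> /(idealN iJ); rewrite opprB [f * _]mulrC.
have [g Hg] : exists g, forall s, size s = size x -> count id s = i ->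
    J (kh b c s - kd x e s - g s * f).
  suff /choice[g Hg] : forall s, exists v, size s = size x -> count id s = i ->
    J (kh b c s - kd x e s - v * f) by exists g.
  move=> s; have [ss|/eqP nss] := eqVneq (size s) (size x); last by exists 0.
  have [cs|/eqP ncs] := eqVneq (count id s) i; last by exists 0.
  by have [w Jw] := He s ss cs; exists w.
exists g => s ss cs; apply: Jf; rewrite /GRing.scale /=.
rewrite (_ : f * _ = f * c s - kd x (kh b c) s + (kd x (kh b c) s - f * kd x g s)).
  apply: idealD; [by []|exact: Jk|].
  rewrite -(subr0 (kd x (kh b c) s)) -(kdK x e s) -kdZ -!kdB.
  apply: kd_local => // t st ct; rewrite [f * _]mulrC; apply: Hg; first by rewrite st.
  by apply: succn_inj; rewrite ct.
by ring.
Qed.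

(* The hypothesis [JJ'] makes multiplication by f an embedding of A/J into
   A/J', with cokernel A/(J' + fA). *)
Lemma acyclic_ext x n J J' f : ideal J -> ideal J' ->
  (forall u, J' (f * u) <-> J u) ->
  acyclic x n J -> acyclic x n (addI J' f) -> acyclic x n J'.
Proof.
move=> iJ iJ' JJ' ac ac' i c lin dc.
have [|e He] := ac' i c lin; first by move=> s ss cs; exact/sub_addI/dc.
have [g Hg] : exists g, forall s, size s = size x -> count id s = i ->
    J' (c s - kd x e s - f * g s).
  suff /choice[g Hg] : forall s, exists v, size s = size x -> count id s = i ->
    J' (c s - kd x e s - f * v) by exists g.
  move=> s; have [ss|/eqP nss] := eqVneq (size s) (size x); last by exists 0.
  have [cs|/eqP ncs] := eqVneq (count id s) i; last by exists 0.
  by have [w Jw] := He s ss cs; exists w; rewrite mulrC.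
have [|g' Hg'] := ac i g lin.
  move=> s ss cs; apply/JJ'.
  rewrite (_ : f * _ = kd x c s - (kd x c s - 0 - f * kd x g s)); last by ring.
  apply: idealB => //; first exact: dc.
  rewrite -(kdK x e s) -kdZ -!kdB; apply: kd_local => // t st ct.
  by apply: Hg; [rewrite st|apply: succn_inj; rewrite ct].
exists (fun s => e s + f * g' s) => s ss cs; rewrite kdD kdZ.
rewrite (_ : _ - _ = c s - kd x e s - f * g s + f * (g s - kd x g' s)); last by ring.
by apply: idealD => //; [exact: Hg|apply/JJ'; exact: Hg'].
Qed.

(** Weak regularity on A/J, with an ideal growing along the sequence instead of the prefixes of
    [weak_regular], so that induction on [s] applies. *)
Fixpoint regular_mod J (s : seq A) : Prop :=
  if s is f :: s' then nzd J f /\ regular_mod (addI J f) s' else True.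

(** Some power f^k of the first element lies in (x) and can be used in [addI_acyclic]. Vanishing
    modulo J + (f^k) follows from vanishing modulo J + (f) by induction on k, since A/(J +
    (f^(k+1))) is an extension of A/(J + (f)) by A/(J + (f^k)). *)
Lemma regular_acyclic x J (s : seq A) : ideal J -> regular_mod J s ->
  (forall f, f \in s -> exists k, gen x (f ^+ k)) -> acyclic x (size s) J.
Proof.
elim: s J => [|f s IH] J iJ /= => [_ _ //|[Jf rs] fx].
have acf : acyclic x (size s) (addI J f).
  by apply: IH => // [|g gs]; [exact: addI_ideal|apply: fx; rewrite inE gs orbT].
have [k xk] := fx f (mem_head _ _).
have Jfk l u : J (f ^+ l * u) -> J u.
  by elim: l u => [|l IHl] u; rewrite ?mul1r // exprS -mulrA => /Jf /IHl.
apply: (addI_acyclic iJ _ xk); first exact: Jfk.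
elim: k {xk} => [|k IHk].
  by apply: acyclic_full; [exact: addI_ideal|exact: addI_mem].
apply: (@acyclic_ext _ _ (addI J (f ^+ k)) _ f) => //; try exact: addI_ideal.
- move=> u; split=> [[v]|[v Ju]].
    by rewrite exprS mulrCA -mulrBr => /Jf Ju; exists v.
  by exists v; rewrite exprS mulrCA -mulrBr; exact: idealMl.
- suff -> : addI (addI J (f ^+ k.+1)) f = addI J f by [].
  apply/seteqP; split=> y; last by case=> v Jv; exists v; exact: sub_addI.
  move=> [v [w Jw]]; exists (v + w * f ^+ k).
  by rewrite mulrDl opprD addrA -mulrA -exprSr.
Qed.

Lemma weak_regular_mod (s : seq A) :
  @weak_regular A A^o s -> regular_mod [set 0] s.
Proof.
rewrite -gen_nilE => rs.
suff H k : (k <= size s)%N -> regular_mod (gen (take (size s - k) s)) (drop (size s - k) s).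
  by have := H (size s) (leqnn _); rewrite subnn take0 drop0.
elim: k => [_|k IH lt]; first by rewrite subn0 drop_size.
have lt' : (size s - k.+1 < size s)%N by rewrite ltn_subrL (leq_ltn_trans _ lt).
rewrite (drop_nth 0) //; split; first exact: rs.
by rewrite -gen_rcons -take_nth // subnSK //; apply: IH; exact: ltnW.
Qed.

End Koszul.

(** * Base change and generic regular sequences *)

Section BaseChange.
Variables A B : comPzRingType.
Implicit Types (J : set A) (K : set B).

Lemma kd_semilinear (phi : A -> B) (psi : {additive B -> A}) x c s :
  (forall a b, psi (phi a * b) = a * psi b) ->
  psi (kd (map phi x) c s) = kd x (psi \o c) s.
Proof.
move=> lin; elim: x c s => [|a x IH] c [|[] s] /=; rewrite ?raddf0 //.
by rewrite raddfB lin IH.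
Qed.

Lemma kd_rmorph (phi : {rmorphism A -> B}) x c s :
  phi (kd x c s) = kd (map phi x) (phi \o c) s.
Proof.
elim: x c s => [|a x IH] c [|[] s] /=; rewrite ?rmorph0 //.
by rewrite rmorphB rmorphM IH.
Qed.

(** The A-linear retraction [psi] makes A/J a direct summand of B/K, hence its cohomology a summand
    as well. *)
Lemma acyclic_retract (phi : {rmorphism A -> B}) (psi : {additive B -> A})
    x n J K :
  (forall a b, psi (phi a * b) = a * psi b) -> cancel phi psi ->
  (forall a, J a -> K (phi a)) -> (forall b, K b -> J (psi b)) ->
  acyclic (map phi x) n K -> acyclic x n J.
Proof.
move=> lin phiK JK KJ ac i c lin_ dc.
have [|e He] := ac i (phi \o c) lin_.
- by move=> s; rewrite size_map => ss cs; rewrite -kd_rmorph; exact/JK/dc.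
- exists (psi \o e) => s ss cs; rewrite -(kd_semilinear _ _ _ lin).
  by rewrite -[c s]phiK -raddfB; apply/KJ/He; rewrite ?size_map.
Qed.

(** Here [phi] induces an isomorphism from A/J to B/K; a primitive found over B is replaced by a
    congruent one with values from A. *)
Lemma acyclic_quotient (phi : {rmorphism A -> B}) x n J K : ideal K ->
  (forall a, K (phi a) <-> J a) -> (forall b, exists a, K (b - phi a)) ->
  acyclic (map phi x) n K -> acyclic x n J.
Proof.
move=> iK JK sur ac i c lin dc.
have [|e He] := ac i (phi \o c) lin.
  by move=> s; rewrite size_map => ss cs; rewrite -kd_rmorph; exact/JK/dc.
have /choice[g Hg] s := sur (e s).
exists g => s ss cs; apply/JK; rewrite rmorphB kd_rmorph.
rewrite (_ : _ - _ = phi (c s) - kd (map phi x) e s +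
    kd (map phi x) (fun s => e s - phi (g s)) s); last by rewrite kdB; ring.
by apply: idealD; [|apply: He; rewrite ?size_map|exact: kd_local].
Qed.

End BaseChange.

(** H^0(x; A/J) is the annihilator of (x) in A/J; the constant cochain g is tested at the all-false
    string. *)
Lemma acyclic_annihilator (A : comPzRingType) (x : seq A) n (J : set A) g :
  ideal J -> acyclic x n.+1 J -> (forall a, a \in x -> J (a * g)) -> J g.
Proof.
move=> iJ ac xg.
have iJg : ideal [set b | J (b * g)].
  split=> [|a b /= Ja Jb|a b /= Jb] /=; first by rewrite mul0r; exact: ideal0.
    by rewrite mulrDl; exact: idealD.
  by rewrite -mulrA; exact: idealMl.
have [//|s ss cs|e He] := ac 0 (fun=> g).
  have := @kd_sub _ _ x (fun=> 1) s iJg xg; rewrite /= mulrC -kdZ.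
  by congr (J (kd _ _ _)); apply/funext => t; rewrite mulr1.
have := He (nseq (size x) false); rewrite size_nseq count_nseq mul0n.
by rewrite kd_deg0 ?subr0 ?count_nseq //; exact.
Qed.

(* McCoy: modulo J, a polynomial whose coefficients have no common nonzero
   annihilator is a nonzerodivisor. *)
Lemma poly_nzd (A : comNzRingType) (J : set A) (f g : {poly A}) : ideal J ->
  (forall u, (forall j, J (f`_j * u)) -> J u) ->
  (forall i, J (f * g)`_i) -> forall i, J g`_i.
Proof.
move=> iJ annf Jfg.
(* Induction on a bound l beyond which the coefficients of h lie in J. *)
suff H l : forall h : {poly A}, (forall i, (l <= i)%N -> J h`_i) ->
    (forall i, J (f * h)`_i) -> forall i, J h`_i.
  by apply: (H (size g)) => // i gi; rewrite nth_default //; exact: ideal0.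
elim: l => [|l IH] h hl Jfh i; first exact: hl.
apply: annf => j; move: i.
(* Downward induction on j shows that f_j h is zero modulo J. In the coefficient of f h at j + l,
   the terms f_k with k > j vanish by this induction and those with k < j by the bound on h, leaving
   f_j h_l. *)
have [d] := ubnP (size f - j); elim: d j => // d IHd j dj i.
have Jhl : J (f`_j * h`_l).
  have := Jfh (j + l)%N; rewrite coefM (bigD1 (inord j)) //=.
  have jE : (inord j : 'I_(j + l).+1) = j :> nat by rewrite inordK // ltnS leq_addr.
  rewrite jE addKn => Js; apply/(ideal_subr iJ); last exact: Js.
  rewrite opprD addrA subrr sub0r; apply: idealN => //.
  apply: ideal_sum => // k /eqP kj.
  have [kltj|jltk|e] := ltngtP k j; last by case: kj; apply/val_inj; rewrite /= jE.
    by apply: idealMl => //; apply: hl; move: kltj; clear; lia.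
  have [fk|kf] := leqP (size f) k.
    by rewrite nth_default // mul0r; exact: ideal0.
  by apply: IHd; lia.
(* The coefficient at l of f_j h now lies in J too, so the bound drops to l. *)
have := IH (f`_j *: h); move=> /(_ _ _ i); rewrite coefZ; apply.
  move=> k; rewrite leq_eqVlt coefZ => /predU1P[<- //|lk].
  by apply: idealMl => //; exact: hl.
by move=> k; rewrite -scalerAr coefZ; exact: idealMl.
Qed.

(** * Koszul cohomology and generic combinations over polynomial rings *)

Section PolynomialRing.
Variables (A : comNzRingType) (m : nat).
Notation B := (mpoly m A).
Notation C := (@mpolyC m A).
Notation X := (fun j => mpolyX A (mnm1 j)).

Lemma mpoly_acyclic_const (x : seq A) n :
  acyclic (map C x) n [set 0] -> acyclic x n [set 0].
Proof.
apply: (@acyclic_retract _ _ C (mcoeff mnm0)).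
- by move=> a b; exact: mcoeffCM.
- exact: mpolyCK.
- by move=> _ ->; exact: rmorph0.
- by move=> _ ->; exact: raddf0.
Qed.

(** The polynomial ring is free over A on the monomials, so primitives are found coefficient by
    coefficient. *)
Lemma mpoly_acyclic (x : seq A) n :
  acyclic x n [set 0] -> acyclic (map C x) n [set 0].
Proof.
move=> ac i c lin dc.
have /choice[e He] mn : exists e, forall s, size s = size x -> count id s = i ->
    mcoeff mn (c s) - kd x e s = 0.
  apply: (ac i (mcoeff mn \o c)) => // s ss cs.
  have lin_ a b : mcoeff mn (C a * b) = a * mcoeff mn b by exact: mcoeffCM.
  by rewrite -(kd_semilinear _ _ _ lin_) dc ?size_map //= raddf0.
(* Only finitely many monomials occur in c at strings of the right length, so the primitives can be
   summed. *)
pose M := undup (flatten [seq msupp (c (val t)) | t : (size x).-tuple bool]).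
exists (fun s => \sum_(mn <- M) mpolyX A mn * C (e mn s)) => s.
rewrite size_map => ss cs; rewrite kd_sum; apply/eqP; rewrite subr_eq0; apply/eqP.
under eq_bigr do rewrite kdZ -[kd _ _ _](kd_rmorph C x (e _)).
under eq_bigr do rewrite -(subr0_eq (He _ s ss cs)) mulrC mul_mpolyC.
apply/mpolyP => k; rewrite raddf_sum /=.
under eq_bigr do rewrite mcoeffZ mcoeffX.
have [kM|kM] := boolP (k \in M).
  rewrite (bigD1_seq k) ?undup_uniq //= eqxx mulr1 big1 ?addr0 // => mn /negPf ->.
  by rewrite mulr0.
rewrite big1_seq => [|mn /andP[_ mnM]].
  apply: memN_msupp_eq0; apply: contra kM => ks; rewrite mem_undup.
  apply/flattenP; exists (msupp (c s)) => //.
  have st : size s == size x by apply/eqP.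
  by apply/mapP; exists (Tuple st); rewrite ?mem_enum.
by case: eqVneq mnM kM => [->|]; [case: (k \in M)|rewrite mulr0].
Qed.

Variable i : 'I_m.

(* The ring morphism A[X] -> A[X][T] replacing X_i by T. *)
Lemma separate_var : exists theta : {rmorphism B -> {poly B}},
  [/\ forall a, theta (C a) = (C a)%:P,
      forall j, theta (X j) = if j == i then 'X else (X j)%:P &
      forall p, (theta p).[X i] = p].
Proof.
exists (mmap (polyC \o C) (fun j => if j == i then 'X else (X j)%:P)); split.
- by move=> a; exact: mmapC.
- by move=> j; rewrite /= mmapX mmap1U.
move=> p; rewrite /= /mmap horner_sum [RHS]mpolyE; apply: eq_bigr => mn _.
rewrite hornerM hornerC /mmap1 horner_prod -mul_mpolyC; congr (_ * _).
rewrite [RHS]mpolyXE_id; apply: eq_bigr => j _; rewrite horner_exp.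
by case: eqP => [->|_]; rewrite ?hornerX ?hornerC.
Qed.

(** The powers of one variable serve as generic coefficients: as a polynomial in X_j, its
    coefficients are exactly the entries of [x], as McCoy's theorem requires. *)
Definition generic_comb (x : seq A) (j : 'I_m) : B :=
  \sum_(k < size x) C x`_k * (X j) ^+ k.

(** The generators of J do not involve X_i. Separating X_i as a new variable T keeps the
    coefficients of the image of J in J and turns the combination into a polynomial with
    coefficients [x]; McCoy's theorem applies, and T = X_i recovers g. *)
Lemma generic_nzd (x : seq A) (I : seq 'I_m) (J := gen (map (generic_comb x) I)) :
  i \notin I ->
  (forall g, (forall a, a \in map C x -> J (a * g)) -> J g) ->
  nzd J (generic_comb x i).
Proof.
move=> iI ann g; rewrite /GRing.scale /= => Jfg.
have iJ : ideal J by exact: gen_ideal.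
have [theta [thC thX thK]] := separate_var.
have thf j : theta (generic_comb x j) =
    if j == i then \poly_(k < size x) C x`_k else (generic_comb x j)%:P.
  rewrite rmorph_sum /=.
  under eq_bigr do rewrite rmorphM rmorphXn /= thC thX.
  case: eqP => _; first by rewrite poly_def; apply: eq_bigr => k _; rewrite mul_polyC.
  by rewrite rmorph_sum; apply: eq_bigr => k _; rewrite rmorphM rmorphXn.
have iS : ideal [set p | forall k, J (theta p)`_k].
  split=> [k|p q /= Jp Jq k|p q /= Jq k].
  - by rewrite rmorph0 coef0; exact: ideal0.
  - by rewrite rmorphD coefD; exact: idealD.
  - rewrite rmorphM coefM; apply: ideal_sum => // l _; exact: idealMl.
have JS : J `<=` [set p | forall k, J (theta p)`_k].
  apply: gen_sub => // _ /mapP[j jI ->] k; rewrite thf.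
  case: eqP => [ji|_]; first by rewrite -ji jI in iI.
  rewrite coefC; case: eqP => _; last exact: ideal0.
  by apply: gen_mem; apply: map_f.
rewrite -[g](thK g) horner_coef; apply: ideal_sum => // k _.
apply: idealMr => //; move: (k : nat) => {}k.
apply: (@poly_nzd _ J (theta (generic_comb x i))) => // [u Ju|l].
  apply: ann => a /(nthP 0)[j]; rewrite size_map => jx <-.
  have := Ju j; rewrite thf eqxx coef_poly jx.
  by rewrite (nth_map 0).
by rewrite -rmorphM; exact: JS.
Qed.

End PolynomialRing.

(** Modulo the first k combinations, cohomology still vanishes below n - k. While k < n this
    includes H^0, so the next combination is a nonzerodivisor. *)
Lemma generic_regular (A : comNzRingType) m (x : seq A) n : (n <= m)%N ->
  acyclic x n [set 0] ->
  @weak_regular (mpoly m A : comNzRingType) (mpoly m A : comNzRingType)^o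
    (map (generic_comb x) (take n (enum 'I_m))).
Proof.
move=> nm ac; pose J k := gen (map (generic_comb x) (take k (enum 'I_m))).
have sE : size (enum 'I_m) = m by rewrite size_enum_ord.
have step k (km : (k < m)%N) : acyclic (map (@mpolyC m A) x) 1 (J k) ->
    nzd (J k) (generic_comb x (Ordinal km)).
  move=> ack; apply: generic_nzd => [|g]; last first.
    by apply: acyclic_annihilator ack; exact: gen_ideal.
  apply/negP => /(nthP (Ordinal km))[j].
  rewrite size_takel ?sE ?(ltnW km) // => jk.
  rewrite nth_take // => /(congr1 val); rewrite /= nth_enum_ord ?(ltn_trans jk) //.
  by move=> e; rewrite e ltnn in jk.
have JS k (km : (k < m)%N) : J k.+1 = addI (J k) (generic_comb x (Ordinal km)).
  rewrite /J (take_nth (Ordinal km)) ?sE // map_rcons gen_rcons.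
  by congr (addI _ (generic_comb _ _)); apply/val_inj; rewrite /= nth_enum_ord.
have acJ k : (k <= n)%N -> acyclic (map (@mpolyC m A) x) (n - k) (J k).
  elim: k => [_|k IH kn]; first by rewrite subn0 /J take0 gen_nilE; exact: mpoly_acyclic.
  have km : (k < m)%N by exact: leq_trans nm.
  rewrite (JS k km); apply: acyclic_addI; first exact: gen_ideal.
    by apply/step/acyclicW/IH; [rewrite subn_gt0|exact: ltnW].
  by rewrite subnSK //; apply: IH; exact: ltnW.
move=> k; rewrite size_map size_takel ?sE // => kn.
have km : (k < m)%N by exact: leq_trans nm.
have Ek : nth (Ordinal km) (take n (enum 'I_m)) k = Ordinal km.
  by apply/val_inj; rewrite /= nth_take // nth_enum_ord.
rewrite (nth_map (Ordinal km)) ?size_takel ?sE // Ek -map_take.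
rewrite take_takel ?(ltnW kn) //; apply/step/acyclicW/acJ; first by rewrite subn_gt0.
exact: ltnW.
Qed.

(** * The polynomial grade as a Koszul grade *)

Definition koszul_degrees (A : comPzRingType) (I : set A) : set nat :=
  [set n | exists2 x : seq A, (forall a, a \in x -> I a) & acyclic x n [set 0]].

Definition koszul_grade (A : comPzRingType) (I : set A) : \bar Rdefinitions.R :=
  ereal_sup [set n%:R%:E | n in koszul_degrees I].

(** The elements generated by the image of some finite sequence in I form an ideal, by concatenation
    of sequences, so they exhaust the extension. *)
Lemma ideal_extP (A B : comPzRingType) (phi : {rmorphism A -> B}) (I : set A)
    (s : seq B) : ideal I -> (forall b, b \in s -> ideal_ext phi I b) ->
  exists2 x : seq A, (forall a, a \in x -> I a) &
    forall b, b \in s -> gen (map phi x) b.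
Proof.
move=> iI.
pose K := [set b | exists2 x : seq A, (forall a, a \in x -> I a) & gen (map phi x) b].
have catI (x y : seq A) : (forall a, a \in x -> I a) -> (forall a, a \in y -> I a) ->
    forall a, a \in x ++ y -> I a.
  by move=> xI yI a; rewrite mem_cat => /orP[/xI|/yI].
have genl (x y : seq A) b : gen (map phi x) b -> gen (map phi (x ++ y)) b.
  by apply: gen_subset => c; rewrite map_cat mem_cat => ->.
have genr (x y : seq A) b : gen (map phi y) b -> gen (map phi (x ++ y)) b.
  by apply: gen_subset => c; rewrite map_cat mem_cat orbC => ->.
have iK : ideal K.
  split; first by exists [::] => //; rewrite gen_nilE.
    move=> b c [x xI xb] [y yI yc]; exists (x ++ y); first exact: catI.
    by apply: (idealD (gen_ideal _)); [exact: genl|exact: genr].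
  move=> b c [x xI xc]; exists x => //; exact: (idealMl _ (gen_ideal _)).
have IK : ideal_ext phi I `<=` K.
  move=> b; apply; split=> // _ [a Ia <-]; exists [:: a] => /=.
    by move=> c; rewrite inE => /eqP ->.
  by apply: gen_mem; rewrite inE.
elim: s => [|b s IH] sI; first by exists [::].
have [|x xI xs] := IH; first by move=> c cs; apply: sI; rewrite inE cs orbT.
have [y yI yb] := IK b (sI b (mem_head _ _)).
exists (y ++ x); first exact: catI.
by move=> c; rewrite inE => /predU1P[->|/xs]; [exact: genl|exact: genr].
Qed.

(** A weak regular sequence in the extended ideal is generated by a finite sequence [x] of I; it
    kills the cohomology of [x] over the polynomial ring, hence over A. *)
Lemma mpoly_grade_le (A : comNzRingType) (I : set A) m : ideal I ->
  (grade (mpoly m A : comNzRingType)^o (ideal_ext (@mpolyC m A) I) <=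
   koszul_grade I)%E.
Proof.
move=> iI; apply: ge_ereal_sup => _ [s [rs sI] <-].
apply: ereal_sup_ubound; exists (size s) => //.
have [x xI xs] := ideal_extP (phi := @mpolyC m A) iI sI.
exists x => //; apply: (@mpoly_acyclic_const A m).
apply: regular_acyclic; [exact: zero_ideal|exact: weak_regular_mod|].
by move=> f fs; exists 1%N; rewrite expr1; exact: xs.
Qed.

Lemma mpoly_grade_ge (A : comNzRingType) (I : set A) m n : (n <= m)%N ->
  koszul_degrees I n ->
  (n%:R%:E <= grade (mpoly m A : comNzRingType)^o (ideal_ext (@mpolyC m A) I))%E.
Proof.
move=> nm [x xI ac]; apply: ereal_sup_ubound.
exists (map (generic_comb x) (take n (enum 'I_m))).
  split; first exact: generic_regular.
  move=> _ /mapP[j _ ->] K [iK IK]; apply: ideal_sum => // k _.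
  by apply: idealMr => //; apply: IK; exists x`_k => //; apply/xI/mem_nth.
by rewrite size_map size_takel // size_enum_ord.
Qed.

(** All grades are at most the Koszul grade, and from n variables on they are at least any Koszul
    degree n. So they are eventually constant if the degrees are bounded, and tend to infinity
    otherwise. *)
Lemma p_grade_koszul (A : comNzRingType) (I : set A) : ideal I ->
  p_grade I = koszul_grade I.
Proof.
move=> iI; apply: cvg_lim => //.
pose u m := grade (mpoly m A : comNzRingType)^o (ideal_ext (@mpolyC m A) I).
have uge n m : koszul_degrees I n -> (n <= m)%N -> (n%:R%:E <= u m)%E.
  by move=> kn nm; exact: mpoly_grade_ge.
have ule m : (u m <= koszul_grade I)%E by exact: mpoly_grade_le.
have k0 : koszul_degrees I 0 by exists [::].
have [[N ubN]|unb] := pselect (exists N, forall n, koszul_degrees I n -> (n <= N)%N).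
  have [k /asboolP kk kmax] := @ex_maxnP (fun n => `[< koszul_degrees I n >]) N
    (ex_intro _ 0%N (asboolT k0)) (fun n kn => ubN n (asboolW kn)).
  have -> : koszul_grade I = k%:R%:E.
    apply/eqP; rewrite eq_le; apply/andP; split; last by apply: ereal_sup_ubound; exists k.
    apply: ge_ereal_sup => _ [n kn <-]; rewrite lee_fin ler_nat.
    by apply: kmax; exact/asboolP.
  apply: cvg_near_cst; exists k => // m /= km; apply/eqP; rewrite eq_le uge // andbT.
  apply: le_trans (ule m) _.
  apply: ge_ereal_sup => _ [n kn <-]; rewrite lee_fin ler_nat.
  by apply: kmax; exact/asboolP.
have big (a : Rdefinitions.R) : exists2 n, koszul_degrees I n & (a <= n%:R).
  apply: contrapT => nb; apply: unb; exists (Num.bound `|a|) => n kn.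
  rewrite leqNgt; apply/negP => bn; apply: nb; exists n => //.
  apply: le_trans (ler_norm a) _; apply: ltW.
  apply: lt_trans (archi_boundP (normr_ge0 a)) _; by rewrite ltr_nat.
have -> : koszul_grade I = +oo%E.
  apply/eqyP => a _; have [n kn an] := big a.
  by apply: (@le_trans _ _ n%:R%:E); [rewrite lee_fin|apply: ereal_sup_ubound; exists n].
apply/cvgeyPge => a; have [n kn an] := big a.
exists n => // m /= nm; apply: (@le_trans _ _ n%:R%:E); first by rewrite lee_fin.
exact: uge.
Qed.

(** * The Koszul grade is at most the Krull dimension *)

Section KrullDimension.
Variable A : comPzRingType.
Implicit Types (J K m : set A) (s x y : seq A).

Definition radical J : set A := [set a | exists k, J (a ^+ k)].

Lemma radical_ideal J : ideal J -> ideal (radical J).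
Proof.
move=> iJ; split=> [|a b [k Jk] [l Jl]|a b [k Jk]].
- by exists 1%N; rewrite expr1; exact: ideal0.
- exists (k + l)%N; rewrite exprDn; apply: ideal_sum => // i _.
  rewrite -mulr_natr; apply: idealMr => //.
  have [li|il] := leqP l i; first by apply: idealMl => //; exact: idealX li _.
  by apply: idealMr => //; apply: (idealX iJ _ Jk); lia.
- by exists k; rewrite exprMn; exact: idealMl.
Qed.

Lemma sub_radical J a : J a -> radical J a.
Proof. by exists 1%N; rewrite expr1. Qed.

Lemma radicalX J a k : radical J (a ^+ k) -> radical J a.
Proof. by case=> l; rewrite -exprM => Ja; exists (k * l)%N. Qed.

(* Krull boundary ideals, as in the elementary characterization of Krull
   dimension by Coquand and Lombardi. *)
Definition boundary J a : set A := [set u | exists c k, J (a ^+ k * (u - c * a))].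

Fixpoint iter_boundary s : set A :=
  if s is a :: s' then boundary (iter_boundary s') a else [set 0].

Lemma boundary_ideal J a : ideal J -> ideal (boundary J a).
Proof.
move=> iJ; split=> [|u v [c [k Jk]] [d [l Jl]]|b u [c [k Jk]]].
- by exists 0, 0%N; rewrite mul0r subr0 mulr0; exact: ideal0.
- exists (c + d), (k + l)%N; rewrite exprD.
  rewrite (_ : _ * _ = a ^+ l * (a ^+ k * (u - c * a)) +
    a ^+ k * (a ^+ l * (v - d * a))).
    by apply: idealD => //; exact: idealMl.
  by move: (a ^+ k) (a ^+ l) => x y; ring.
- exists (b * c), k; rewrite (_ : a ^+ k * _ = b * (a ^+ k * (u - c * a))); last first.
    by move: (a ^+ k) => x; ring.
  exact: idealMl.
Qed.

Lemma iter_boundary_ideal s : ideal (iter_boundary s).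
Proof. by elim: s => [|a s IH]; [exact: zero_ideal|exact: boundary_ideal]. Qed.

Definition prime_chain n (p : nat -> set A) : Prop :=
  (forall i, (i <= n)%N -> prime_ideal (p i)) /\
  (forall i, (i < n)%N -> p i `<` p i.+1).

(** A prime q over the boundary of J at a contains a and every w with a^k w in J. Hence the products
    of powers of a with elements outside q avoid J, and a prime over J missing them lies strictly
    below q. *)
Lemma boundary_chain s q : prime_ideal q -> iter_boundary s `<=` q ->
  exists2 p, prime_chain (size s) p & p (size s) = q.
Proof.
elim: s q => [|a s IH] q pq sq; first by exists (fun=> q) => //; split.
have [iq q1 mq] := pq.
have [|u v|u su|P [pP sP PS _]] := @ideal_disjoint_prime _ (iter_boundary s)
    [set u | exists k w, u = a ^+ k * w /\ ~ q w] (iter_boundary_ideal s).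
- by exists 0%N, 1; rewrite mulr1.
- move=> [k [w [-> qw]]] [l [z [-> qz]]]; exists (k + l)%N, (w * z).
  by split; [rewrite exprD mulrACA|case/mq].
- move=> [k [w [uE qw]]]; apply/qw/sq; exists 0, k.
  by rewrite mul0r subr0 -uE.
have Pq : P `<=` q.
  move=> w Pw; apply: contrapT => qw; apply: (PS w) => //.
  by exists 0%N, w; rewrite mul1r.
have Pa : ~ P a by move=> Pa; apply: (PS a) => //; exists 1%N, 1; rewrite mulr1 expr1.
have qa : q a.
  apply: sq; exists 1, 0%N; rewrite !mul1r subrr.
  exact: ideal0 (iter_boundary_ideal s).
have [p [pp ps] pE] := IH P pP sP.
exists (fun i => if (i <= size s)%N then p i else q); last by rewrite /= ltnn.
split=> i /=; first by case: ifP => // ile _; exact: pp.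
rewrite ltnS => isz; have [lt|ge] := ltnP i (size s).
  by rewrite (ltnW lt); exact: ps.
have -> : i = size s by apply/eqP; rewrite eqn_leq isz.
by rewrite leqnn pE; split=> // qP; exact/Pa/qP.
Qed.

Lemma iter_boundary1 s : ~ (exists p, prime_chain (size s) p) -> iter_boundary s 1.
Proof.
move=> nc; apply: contrapT => s1; apply: nc.
have [q pq sq] := ideal_sub_prime (iter_boundary_ideal s) s1.
by have [p cp _] := boundary_chain pq sq; exists p.
Qed.

(* Kronecker's theorem: y is obtained from the identity
   rad(a, b) = rad(a + b, ab), the product ab being absorbed recursively. *)
Lemma kronecker_step s g k : iter_boundary s (g ^+ k) ->
  exists y, [/\ size y = size s, forall b, b \in y -> gen (g :: s) b &
    forall b, b \in g :: s -> radical (gen y) b].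
Proof.
elim: s g k => [|a s IH] g k /= sg.
  exists [::]; split=> // b; rewrite inE => /eqP ->; exists k.
  by rewrite gen_nilE.
(* The extra factor g in b = g(g^k - ca) keeps b in the ideal (g, a, s) even when k = 0, while a^l
   (g^k - ca) in the boundary of s makes (ab)^(l+1) lie there. *)
have [c [l sl]] := sg; pose b := g ^+ k.+1 - g * c * a.
have isb := iter_boundary_ideal s.
have [|y [sy ygen yrad]] := IH (a * b) l.+1.
  rewrite (_ : _ ^+ _ = a * b ^+ l * g * (a ^+ l * (g ^+ k - c * a))).
    exact: idealMl.
  rewrite /b exprMn !exprS; move: (a ^+ l) (_ ^+ l) (g ^+ k) => u v w; ring.
have ig := gen_ideal [:: g, a & s].
have gg : gen [:: g, a & s] g by apply: gen_mem; rewrite mem_head.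
have ga : gen [:: g, a & s] a by apply: gen_mem; rewrite !inE eqxx orbT.
have gb : gen [:: g, a & s] b.
  apply: (idealB ig); last exact: (idealMl _ ig).
  by rewrite exprSr; exact: (idealMl _ ig).
exists (a + b :: y); split; first by rewrite /= sy.
  move=> u; rewrite inE => /predU1P[->|/ygen]; first exact: (idealD ig).
  apply: gen_sub => // v; rewrite inE => /predU1P[->|vs].
    exact: (idealMr _ ig).
  by apply: gen_mem; rewrite !inE vs !orbT.
set Y := radical _; have iY : ideal Y by exact/radical_ideal/gen_ideal.
have yY u : u \in a * b :: s -> Y u.
  move=> /yrad[r yr]; exists r; apply: gen_subset yr => v vy.
  by rewrite inE vy orbT.
have Yab : Y (a + b) by apply/sub_radical/gen_mem; rewrite mem_head.
have Ya : Y a.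
  apply: (@radicalX _ _ 2); rewrite -/Y (_ : _ ^+ 2 = (a + b) * a - a * b); last by ring.
  by apply: idealB => //; [exact: idealMr|apply: yY; rewrite mem_head].
have Yb : Y b by rewrite -(addKr a b) addrC; exact: idealB.
move=> u; rewrite !inE => /or3P[/eqP ->|/eqP -> //|us].
  apply: (@radicalX _ _ k.+1); rewrite -/Y -(subrK (g * c * a) (g ^+ _)).
  by apply: idealD => //; exact: idealMl.
by apply: yY; rewrite inE us orbT.
Qed.

(** The elements of [x] are absorbed one at a time into d generators, starting from d zeros. *)
Lemma kronecker_local m d x : local_ring m ->
  (forall s, size s = d.+1 -> iter_boundary s 1) -> (forall a, a \in x -> m a) ->
  exists y, [/\ size y = d, forall a, a \in y -> m a &
    forall a, a \in x -> radical (gen y) a].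
Proof.
move=> lm bd; have [[im m1 _] _] := lm.
elim: x => [|g x IH] xm.
  exists (nseq d 0); rewrite size_nseq; split=> // a.
  by rewrite mem_nseq => /andP[_ /eqP ->]; exact: ideal0.
have [|y [sy ym yx]] := IH; first by move=> a ax; apply: xm; rewrite inE ax orbT.
have mg : m g by apply: xm; rewrite mem_head.
have [c [k yk]] : iter_boundary (g :: y) 1 by apply: bd; rewrite /= sy.
(* The boundary condition reads g^k (1 - cg) in [iter_boundary y]; as g is in m, the second factor
   is a unit and g^k itself lies there. *)
have [v v1] : exists v, v * (1 - c * g) = 1.
  apply: (local_ring_unit lm) => mcg; apply: m1.
  by apply/(ideal_subr (x := 1) im mcg); exact: idealMl.
have [|z [sz zg zr]] := @kronecker_step y g k.
  rewrite -[g ^+ k]mulr1 -v1 mulrCA; apply: idealMl => //.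
  exact: iter_boundary_ideal.
exists z; split; first by rewrite sz.
  move=> a /zg; apply: gen_sub => // b; rewrite inE => /predU1P[->//|]; exact: ym.
have iz : ideal (radical (gen z)) by exact/radical_ideal/gen_ideal.
move=> a; rewrite inE => /predU1P[->|/yx[l yl]]; first by apply: zr; rewrite mem_head.
apply: (@radicalX _ _ l); apply: gen_sub yl => // b bz.
by apply: zr; rewrite inE bz orbT.
Qed.

End KrullDimension.

(** Vanishing for [x] gives n generic combinations forming a weak regular sequence; powers of these
    lie in the ideal generated by [y] over the polynomial ring, so [regular_acyclic] transfers the
    vanishing to [y]. *)
Lemma acyclic_radical_nz (A : comNzRingType) (x y : seq A) n :
  (forall a, a \in x -> radical (gen y) a) ->
  acyclic x n [set 0] -> acyclic y n [set 0].
Proof.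
move=> xy ac; apply: (@mpoly_acyclic_const A n).
have rs := weak_regular_mod (generic_regular (leqnn n) ac).
have := regular_acyclic (x := map (@mpolyC n A) y) (@zero_ideal _) rs.
rewrite size_map size_takel ?size_enum_ord //; apply.
move=> _ /mapP[j _ ->].
suff : radical (gen (map (@mpolyC n A) y)) (generic_comb x j) by [].
have iy : ideal (radical (gen (map (@mpolyC n A) y))).
  exact/radical_ideal/gen_ideal.
apply: ideal_sum => // k _; apply: idealMr => //.
have [l yl] := xy _ (mem_nth 0 (ltn_ord k)).
exists l; rewrite -rmorphXn.
have ip : ideal [set a | gen (map (@mpolyC n A) y) (@mpolyC n A a)].
  have ig := gen_ideal (map (@mpolyC n A) y).
  split=> [|a b|a b] /=; rewrite ?rmorph0 ?rmorphD ?rmorphM.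
  - exact: ideal0.
  - exact: idealD.
  - exact: idealMl.
apply: (gen_sub ip) yl => a ay.
by apply: gen_mem; exact: map_f.
Qed.

Lemma acyclic_radical (A : comPzRingType) (x y : seq A) n :
  (forall a, a \in x -> radical (gen y) a) ->
  acyclic x n [set 0] -> acyclic y n [set 0].
Proof.
have [A0|A1] := eqVneq (1 : A) 0.
  by move=> _ _; apply: acyclic_full; [exact: zero_ideal|exact: A0].
exact: (@acyclic_radical_nz (nonzero_ring A1)).
Qed.

(** Without a chain of length d + 1, Kronecker's theorem yields d elements of m, and vanishing
    through degree d would make them generate the unit ideal. *)
Lemma koszul_grade_le_dim (A : comNzRingType) (m : set A) : local_ring m ->
  (koszul_grade m <= krull_dim A)%E.
Proof.
move=> lm; have [[im m1 _] _] := lm.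
apply: ge_ereal_sup => _ [n [x xm ac] <-]; apply: ereal_sup_ubound.
exists n => //; case: n ac => [_|d ac].
  by have [p pp _] := ideal_sub_prime im m1; exists (fun=> p); split.
apply: contrapT => nc.
have [s sd|y [sy ym yx]] := @kronecker_local _ m d x lm _ xm.
  by apply: iter_boundary1; rewrite sd.
apply: m1; apply: (acyclic_top im _ ym (acyclic_radical yx ac)).
  by move=> _ ->; exact: ideal0.
by rewrite sy.
Qed.

(** * Comparison with the completion *)

Section CompletionMap.
Variable R : idomainType.
Notation Rt := (completion R).
Notation nz := {r : R | r != 0}.
Notation cmpt f t := (completion_val f t).

Fact to_completion_coherent (a : R) :
  coherent ((fun t : nz => quo_pi (val t) a) : quo_prod R).
Proof.
apply/asboolP => r s [c sE] b /quo_eqP[d ab]; apply/quo_eqP.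
by exists (d * c); rewrite ab sE mulrA.
Qed.

Definition to_completion (a : R) : Rt := Completion (to_completion_coherent a).

Lemma completionP (f g : Rt) : (forall t, cmpt f t = cmpt g t) -> f = g.
Proof. by move=> fg; apply/val_inj/functional_extensionality_dep. Qed.

Fact to_completion_zmod : zmod_morphism to_completion.
Proof. by move=> a b; apply: completionP => t; exact: (rmorphB (quo_pi (val t))). Qed.

HB.instance Definition _ :=
  GRing.isZmodMorphism.Build R Rt to_completion to_completion_zmod.

Fact to_completion_monoid : monoid_morphism to_completion.
Proof.
split; first by apply: completionP => t; exact: (rmorph1 (quo_pi (val t))).
by move=> a b; apply: completionP => t; exact: (rmorphM (quo_pi (val t))).
Qed.

HB.instance Definition _ :=
  GRing.isMonoidMorphism.Build R Rt to_completion to_completion_monoid.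

Lemma completion_coh (f : Rt) (r s : nz) a : (exists c, val s = c * val r) ->
  cmpt f s = quo_pi (val s) a -> cmpt f r = quo_pi (val r) a.
Proof. by move=> rs; have /asboolP := completion_coherent f; exact. Qed.

(** The component of index r kills the right-hand side. *)
Lemma to_completion_dvd r a (g : Rt) : r != 0 ->
  to_completion a = to_completion r * g -> exists c, a = c * r.
Proof.
move=> r0 /(congr1 (fun f : Rt => cmpt f (Sub r r0))).
change (quo_pi r a = quo_pi r r * cmpt g (Sub r r0) -> exists c, a = c * r).
rewrite -(quo_piK (cmpt g _)) -rmorphM => /quo_eqP[c e].
by exists (c + repr (cmpt g (Sub r r0))); rewrite mulrDl -e [_ * r]mulrC subrK.
Qed.

(** The component at s is determined by the one at sr, a multiple of s once r is cancelled in the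
    domain R. *)
Lemma to_completion_nzd r (g : Rt) : r != 0 -> to_completion r * g = 0 -> g = 0.
Proof.
move=> r0 rg0; apply: completionP => s.
have rs0 : val s * r != 0 by rewrite mulf_neq0 // (valP s).
pose u : nz := Sub (val s * r) rs0.
have := congr1 (fun f : Rt => cmpt f u) rg0.
change (quo_pi (val u) r * cmpt g u = 0 -> cmpt g s = 0).
have gu : cmpt g u = quo_pi (val u) (repr (cmpt g u)) by rewrite quo_piK.
rewrite gu -rmorphM -(rmorph0 (quo_pi (val u))) => /quo_eqP[c].
rewrite subr0 /= mulrA [RHS]mulrC => /(mulfI r0) e.
rewrite (@completion_coh g s u _ _ gu); last by exists r; rewrite mulrC.
by rewrite -(rmorph0 (quo_pi (val s))); apply/quo_eqP; exists c; rewrite subr0.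
Qed.

(* The quotient by r of an element f with f_r = 0 is obtained from the
   components f_{rs}. *)
Lemma to_completion_surj r (f : Rt) : r != 0 ->
  exists a g, f = to_completion a + to_completion r * g.
Proof.
move=> r0; pose t : nz := Sub r r0; pose a := repr (cmpt f t).
pose f' : Rt := f - to_completion a.
have f'E s : cmpt f' s = cmpt f s - quo_pi (val s) a by [].
have f't : cmpt f' t = quo_pi r 0 by rewrite f'E /= /a quo_piK subrr rmorph0.
have rs0 (s : nz) : val s * r != 0 by rewrite mulf_neq0 // (valP s).
pose u s : nz := Sub (val s * r) (rs0 s).
have /choice[b bE] (s : nz) : exists b, cmpt f' (u s) = quo_pi (val (u s)) (r * b).
  have fu : cmpt f' (u s) = quo_pi (val (u s)) (repr (cmpt f' (u s))) by rewrite quo_piK.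
  have := @completion_coh f' t (u s) _ (ex_intro _ (val s) erefl) fu.
  rewrite f't => /esym /quo_eqP[c]; rewrite subr0 => e.
  by exists c; rewrite fu e mulrC.
have cb : coherent ((fun s : nz => quo_pi (val s) (b s)) : quo_prod R).
  (* If s divides s', coherence of f' between sr and s'r gives r b(s') = r b(s) modulo sr, and r
     cancels. *)
  apply/asboolP => s s' [c s'E] d /quo_eqP[e bd].
  have := @completion_coh f' (u s) (u s') _ _ (bE s').
  rewrite bE => /(_ _)/quo_eqP[|k]; first by exists c; rewrite /= s'E mulrA.
  rewrite -mulrBr /= mulrA [RHS]mulrC => /(mulfI r0) bb.
  apply/quo_eqP; exists (k + e * c).
  by rewrite mulrDl -bb -mulrA -s'E -bd addrA subrK.
exists a, (Completion cb); rewrite -[LHS](subrK (to_completion a)) addrC.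
congr (_ + _); rewrite -/f'; apply: completionP => s.
change (cmpt f' s = quo_pi (val s) r * quo_pi (val s) (b s)).
rewrite -rmorphM; apply: (completion_coh (s := u s)); last exact: bE.
by exists r; rewrite /= mulrC.
Qed.

End CompletionMap.

(* Comparison along a ring morphism inducing an isomorphism A/rA -> B/rB, with
   r a nonzerodivisor in B. *)
Section Comparison.
Variables (A B : comPzRingType) (phi : {rmorphism A -> B}).

Definition quotient_iso (r : A) : Prop :=
  [/\ forall a g, phi a = phi r * g -> exists c, a = c * r,
      forall f, exists a g, f = phi a + phi r * g &
      forall g, phi r * g = 0 -> g = 0].

(** For p containing r, the ideal of B corresponding to p/rA under the isomorphism of A/rA with
    B/rB. *)
Definition prime_lift (r : A) (p : set A) : set B :=
  [set f | exists2 a, p a & exists g, f = phi a + phi r * g].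

Lemma prime_liftP r p a g : quotient_iso r -> ideal p -> p r ->
  prime_lift r p (phi a + phi r * g) <-> p a.
Proof.
move=> [inj _ _] ip pr; split=> [[b pb [h e]]|pa]; last by exists a => //; exists g.
have [|c ab] := inj (a - b) (h - g).
  rewrite rmorphB mulrBr; apply/eqP; rewrite subr_eq addrAC eq_sym subr_eq eq_sym.
  by rewrite e addrC.
by apply/(ideal_subr (y := b) ip) => //; rewrite ab; exact: idealMl.
Qed.

Lemma prime_lift_prime r p : quotient_iso r -> prime_ideal p -> p r ->
  prime_ideal (prime_lift r p).
Proof.
move=> qr pp pr; have [ip p1 pM] := pp; have [inj sur nz] := qr.
have mulE a g b h : (phi a + phi r * g) * (phi b + phi r * h) =
    phi (a * b) + phi r * (phi a * h + g * phi b + g * phi r * h).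
  by rewrite rmorphM; ring.
split; first split.
- by exists 0; [exact: ideal0|exists 0; rewrite rmorph0 mulr0 addr0].
- move=> _ _ [a pa [g ->]] [b pb [h ->]]; exists (a + b); first exact: idealD.
  by exists (g + h); rewrite rmorphD mulrDr addrACA.
- move=> f _ [b pb [h ->]]; have [a [g ->]] := sur f.
  by rewrite mulE; apply/(prime_liftP _ _ qr ip pr); exact: idealMl.
- by have := prime_liftP 1 0 qr ip pr; rewrite rmorph1 mulr0 addr0 => ->.
move=> f1 f2; have [a [g ->]] := sur f1; have [b [h ->]] := sur f2.
by rewrite mulE !(prime_liftP _ _ qr ip pr); exact: pM.
Qed.

(** Choosing a nonzero r in p 1, the primes from p 1 upwards lift through the quotients by r; p 0 is
    replaced by a prime of B below the lift of p 1 that misses r. *)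
Lemma krull_dim_le : 1 != 0 :> B -> (forall r, r != 0 -> quotient_iso r) ->
  (krull_dim A <= krull_dim B)%E.
Proof.
move=> B1 qi; apply: ge_ereal_sup => _ [n [p [pp ps]] <-].
apply: ereal_sup_ubound; exists n => //; case: n pp ps => [|n] pp ps.
  have [|P pP _] := @ideal_sub_prime _ _ (@zero_ideal B).
    by move=> /= e; rewrite e eqxx in B1.
  by exists (fun=> P); split.
have [r [p1r nz_r]] : exists r, p 1%N r /\ r != 0.
  have [_ p10] := ps 0%N isT; apply: contrapT => nr; apply: p10 => a p1a.
  have [->|a0] := eqVneq a 0; first by have [/ideal0] := pp 0%N isT.
  by case: nr; exists a.
have qr := qi r nz_r; have [inj sur nzr] := qr.
have pr i : (0 < i)%N -> (i <= n.+1)%N -> p i r.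
  elim: i => // -[//|i] IH _ iin.
  by have [+ _] := ps i.+1 iin; apply; apply: IH => //; exact: ltnW.
have pP i : (0 < i)%N -> (i <= n.+1)%N -> prime_ideal (prime_lift r (p i)).
  by move=> i0 iin; apply: prime_lift_prime; [|exact: pp|exact: pr].
have [iP P1 PM] := pP 1%N isT isT.
(* The multiplicative set generated by r and the complement of the lift of
   p 1 avoids 0 because r is a nonzerodivisor. *)
have [|u v|u u0|P0 [pP0 _ P0S _]] := @ideal_disjoint_prime _ [set 0]
    [set u | exists k w, u = phi r ^+ k * w /\ ~ prime_lift r (p 1%N) w] (@zero_ideal B).
- by exists 0%N, 1; rewrite mulr1.
- move=> [k [w [-> nw]]] [l [z [-> nzz]]]; exists (k + l)%N, (w * z).
  by split; [rewrite exprD mulrACA|case/PM].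
- move=> [k [w [uE nw]]]; apply: nw.
  suff -> : w = 0 by exact: ideal0.
  move: uE; rewrite u0 => {u u0}.
  by elim: k w => [|k IH] w; rewrite ?mul1r // exprS -mulrA => /esym/nzr/esym/IH.
exists (fun i => if i is 0%N then P0 else prime_lift r (p i)); split=> -[|i] iin //=.
- exact: pP.
- split=> [w P0w|P0P].
    by apply: contrapT => nw; apply: (P0S w) => //; exists 0%N, w; rewrite mul1r.
  apply: (P0S (phi r)); last by exists 1%N, 1; rewrite mulr1 expr1.
  apply: P0P; exists r => //; exists 0; by rewrite mulr0 addr0.
have [ps1 ps2] := ps i.+1 iin; split=> [f [a pa ag]|P0P].
  by exists a => //; exact: ps1.
apply: ps2 => a pa; have [ipi _ _] := pp i.+1 (ltnW iin).
apply/(prime_liftP a 0 qr ipi (pr i.+1 isT (ltnW iin))).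
by apply: P0P; exists a => //; exists 0.
Qed.

(** The image of r is a nonunit, hence in n. Were the representative a of f outside m, its image
    would be a unit congruent to f modulo r, hence a unit in n. *)
Lemma local_lift r (m : set A) (n : set B) (f : B) : quotient_iso r ->
  local_ring m -> local_ring n -> m r -> n f ->
  exists2 a, m a & exists g, f = phi a + phi r * g.
Proof.
move=> [inj sur nz] lm ln mr nf; have [[im m1 _] _] := lm; have [[iN n1 _] _] := ln.
have nr : n (phi r).
  apply: (local_ring_sub ln (gen_ideal [:: phi r])); last by apply: gen_mem; rewrite inE.
  move=> /gen_cons[g]; rewrite gen_nilE => /eqP; rewrite subr_eq0 => /eqP e.
  have [|c cE] := inj 1 g; first by rewrite rmorph1 e mulrC.
  by apply: m1; rewrite cE; exact: idealMl.
have [a [g fE]] := sur f; exists a; last by exists g.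
apply: contrapT => ma; have [b ba] := local_ring_unit lm ma.
apply: n1; rewrite -(rmorph1 phi) -ba rmorphM; apply: idealMl => //.
rewrite -(addrK (phi r * g) (phi a)) -fE; apply: idealB => //.
exact: idealMr.
Qed.

(** Representatives in m of [y], together with r, generate over B an ideal containing [y], so they
    inherit its vanishing range. Dividing by r over B loses one degree, B/rB is A/rA, and lifting
    from A/rA to A regains it because r is in the sequence. *)
Lemma koszul_grade_ge r (m : set A) (n : set B) : quotient_iso r ->
  (forall a, r * a = 0 -> a = 0) -> local_ring m -> local_ring n -> m r ->
  (koszul_grade n <= koszul_grade m)%E.
Proof.
move=> qr rnz lm ln mr; apply: ge_ereal_sup => _ [k [y yn ac] <-].
apply: ereal_sup_ubound; exists k => //; case: k ac => [_|k ac]; first by exists [::].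
have /choice[h hE] f : exists a, n f -> m a /\ exists g, f = phi a + phi r * g.
  have [nf|nf] := pselect (n f); last by exists 0.
  by have [a ma ag] := local_lift qr lm ln mr nf; exists a.
pose x := r :: map h y; have [inj sur nz] := qr.
have genx f : f \in y -> gen (map phi x) f.
  move=> fy; have [_ [g ->]] := hE f (yn f fy).
  apply: (idealD (gen_ideal _)).
    by apply: gen_mem; rewrite inE map_f ?orbT // map_f.
  by apply: (idealMr _ (gen_ideal _)); apply: gen_mem; rewrite mem_head.
exists x.
  move=> a; rewrite inE => /predU1P[->//|/mapP[f fy ->]].
  by have [] := hE f (yn f fy).
have zA := @zero_ideal A; have zB := @zero_ideal B.
apply: (addI_acyclic (f := r)) => //.
- by apply: gen_mem; rewrite mem_head.
apply: (@acyclic_quotient _ _ phi _ _ _ (addI [set 0] (phi r))).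
- exact: addI_ideal.
- move=> a; split=> -[c /eqP]; rewrite subr_eq0 => /eqP e.
    have [|d ->] := inj a c; first by rewrite e mulrC.
    by exists d; rewrite subrr.
  by exists (phi c); rewrite e rmorphM subrr.
- move=> f; have [a [g ->]] := sur f; exists a, g.
  by rewrite (addrC (phi a)) addrK [phi r * g]mulrC subrr.
apply: acyclic_addI => //.
apply: acyclic_radical ac => f fy; exact/sub_radical/genx.
Qed.

End Comparison.

Theorem proposition6p3 (R : idomainType) (m : set R)
  (Rlocal : local_ring m) (CM : Cohen_Macaulay (completion R)) :
  Cohen_Macaulay R.
Proof.
have [B1 [n ln pgE]] := CM.
have [[im m1 _] _] := Rlocal.
have [[iN _ _] _] := ln.
have qi r : r != 0 -> quotient_iso (@to_completion R) r.
  move=> r0; split=> [a g|f|g].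
  - exact: to_completion_dvd.
  - exact: to_completion_surj.
  - exact: to_completion_nzd.
(* Otherwise R is a field, all quotients R/rR vanish, and the completion is zero, contrary to
   [B1]. *)
have [r mr r0] : exists2 r, m r & r != 0.
  apply: contrapT => nr; case/eqP: (B1).
  rewrite -(rmorph1 (@to_completion R)) -(rmorph0 (@to_completion R)).
  apply: completionP => t; apply: (quo_eqP _ _ _).2; rewrite subr0.
  have [mt|/(local_ring_unit Rlocal)[c ct]] := pselect (m (val t)).
    by case: nr; exists (val t) => //; exact: (valP t).
  by exists c.
exists (oner_neq0 R), m => //.
rewrite (@p_grade_koszul (nonzero_ring (oner_neq0 R)) m im).
rewrite (@p_grade_koszul (nonzero_ring B1) n iN) in pgE.
apply/eqP; rewrite eq_le; apply/andP; split.
  exact: (@koszul_grade_le_dim (nonzero_ring (oner_neq0 R)) m Rlocal).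
apply: le_trans (krull_dim_le B1 qi) _; rewrite -pgE.
apply: (@koszul_grade_ge R (completion R) (@to_completion R) r) => //; first exact: qi.
by move=> a /eqP; rewrite mulf_eq0 (negPf r0) => /eqP.
Qed.
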